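(* Let $(L,Q)$, $(L',Q')$, $(L'',Q'')$ be $L_\infty$-algebras, let $F_0,F_1$ be two homotopic $L_\infty$-morphisms from $(L,Q)$ to $(L',Q')$, and let $H$ be an $L_\infty$-morphism from $(L'',Q'')$ to $(L,Q)$. Then the $L_\infty$-morphisms $F_0H$ and $F_1H$ from $(L'',Q'')$ to $(L',Q')$ are homotopic, $F_0H\sim F_1H$.
   Context: Everything is over a field $\mathbb K$ of characteristic $0$. $L[1]^k=L^{k+1}$; $\overline{\mathrm{Sym}}(L[1])=\bigoplus_{n\ge1}\mathrm{Sym}^n(L[1])$ is the cofree graded cocommutative coalgebra without counit, with coproduct $\overline\Delta$ (sum over unshuffles with Koszul signs) and iterated coproducts $\overline\Delta^{n-1}$ with values in $n$ tensor factors. An $L_\infty$-algebra $(L,Q)$ is a graded vector space $L$ with a degree $+1$ coderivation $Q$ of $\overline{\mathrm{Sym}}(L[1])$, $Q^2=0$, with components $Q_n^1\colon\mathrm{Sym}^n(L[1])\to L[2]$. An $L_\infty$-morphism is a degree $0$ coalgebra morphism $F$ with $FQ=Q'F$; it is determined by its components $F^1_n\colon\mathrm{Sym}^n(L[1])\to L'[1]$. Convolution $L_\infty$-algebra: $\mathcal H=\mathrm{Hom}(\overline{\mathrm{Sym}}(L[1]),L')$ (graded linear maps; if $L,L'$ carry complete descending filtrations, maps and $L_\infty$-morphisms are required to be compatible with them) has the $L_\infty$-structure $\widehat Q$ with $\widehat Q^1_1F=Q'^1_1\circ F-(-1)^{|F|}F\circ Q$ and $\widehat Q^1_n(F_1\vee\cdots\vee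 F_n)=(Q')^1_n\circ\vee^{n-1}\circ(F_1\otimes\cdots\otimes F_n)\circ\overline\Delta^{n-1}$ for $n\ge2$, with $|F|$ the degree in $\mathcal H[1]$. It has the complete filtration $\mathcal F^k\mathcal H=\{f: f|_{\mathrm{Sym}^{<k}(L[1])}=0\}$, $\mathcal F^1\mathcal H=\mathcal H$. Its Maurer--Cartan elements ($F\in(\mathcal H[1])^0$ with $\sum_{n>0}\frac1{n!}\widehat Q^1_n(F\vee\cdots\vee F)=0$) are identified with $L_\infty$-morphisms. Two $L_\infty$-morphisms are homotopic ($\sim$) if they are related by the transitive closure of the relation: there exist $F(t)\in\widehat{(\mathcal H[1])^0[t]}$ and $\lambda(t)\in\widehat{(\mathcal H[1])^{-1}[t]}$ with $\frac{d}{dt}F(t)=\sum_{n\ge0}\frac1{n!}\widehat Q^1_{n+1}(\lambda(t)\vee F(t)\vee\cdots\vee F(t))$, $F(0)=F_0$, $F(1)=F_1$. Here $\widehat{V[t]}\subseteq V[[t]]$ denotes the series that are polynomial in $t$ modulo $\mathcal F^n$ for every $n$. *)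

(* Defs.v *)
From HB Require Import structures.
From mathcomp Require Import all_boot all_order all_algebra.
From mathcomp Require Import boolp.
From mathcomp Require Import finmap monalg.
From Stdlib Require Import Relation_Operators.

Set Implicit Arguments.
Unset Strict Implicit.
Unset Printing Implicit Defensive.

Import Order.TTheory GRing.Theory Num.Theory.
Local Open Scope ring_scope.
Local Open Scope quotient_scope.

(* The K-module with generators T and relators R.                             *)
Section Presented.
Variables (K : fieldType) (T : choiceType) (R : {malg K[T]} -> Prop).

Inductive relspan : {malg K[T]} -> Prop :=
| relspan0 : relspan 0
| relspanD a r x : R r -> relspan x -> relspan (a *: r + x).

Lemma relspan_add x y : relspan x -> relspan y -> relspan (x + y).
Proof.
move=> hx hy; elim: hx => [|a r z hr hz IH]; first by rewrite add0r.
by rewrite -addrA; apply: relspanD.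
Qed.

Lemma relspan_scale a x : relspan x -> relspan (a *: x).
Proof.
elim=> [|b r z hr hz IH]; first by rewrite scaler0; constructor.
by rewrite scalerDr scalerA; apply: relspanD.
Qed.

Definition relsub : {pred {malg K[T]}} := fun x => `[< relspan x >].

Lemma relsub_closed : zmod_closed relsub.
Proof.
split; first by apply/asboolP; constructor.
move=> x y /asboolP hx /asboolP hy; apply/asboolP; apply: relspan_add => //.
by rewrite -scaleN1r; apply: relspan_scale.
Qed.

HB.instance Definition _ := GRing.isZmodClosed.Build _ relsub relsub_closed.

Definition pres := {ideal_quot relsub}.
HB.instance Definition _ := GRing.Zmodule.on pres.

Definition pclass : {malg K[T]} -> pres := locked \pi_({ideal_quot relsub}).
Definition pgen : T -> pres := locked (fun t => pclass << t >>).

Lemma pgenE t : pgen t = pclass << t >>. Proof. by rewrite /pgen -lock. Qed.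

Lemma pclass_is_zmod_morphism : zmod_morphism pclass.
Proof. by rewrite /pclass -lock; exact: (raddfB (\pi_({ideal_quot relsub}))). Qed.
HB.instance Definition _ :=
  GRing.isZmodMorphism.Build {malg K[T]} pres pclass pclass_is_zmod_morphism.

Lemma pclassK (x : pres) : pclass (repr (x : {ideal_quot relsub})) = x.
Proof. by rewrite /pclass -lock; exact: reprK. Qed.

Lemma pclass_eq0 x : pclass x = 0 <-> relspan x.
Proof.
rewrite -(raddf0 pclass) /= /pclass -lock.
split=> [/eqP|h]; first by rewrite -Quotient.idealrBE subr0 => /asboolP.
by apply/eqP; rewrite -Quotient.idealrBE subr0; apply/asboolP.
Qed.

Definition pscale : K -> pres -> pres :=
  locked (fun a x => pclass (a *: repr (x : {ideal_quot relsub}))).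

Lemma pscale_pclass a x : pscale a (pclass x) = pclass (a *: x).
Proof.
apply/eqP; rewrite -subr_eq0 /pscale -lock -raddfB -scalerBr; apply/eqP/pclass_eq0.
by apply: relspan_scale; apply/pclass_eq0; rewrite raddfB /= pclassK subrr.
Qed.

Lemma pscaleA a b x : pscale a (pscale b x) = pscale (a * b) x.
Proof. by rewrite -[x]pclassK !pscale_pclass scalerA. Qed.
Lemma pscale1 : left_id 1 pscale.
Proof. by move=> x; rewrite -[x]pclassK pscale_pclass scale1r. Qed.
Lemma pscaleDr : right_distributive pscale +%R.
Proof.
move=> a x y; rewrite -[x]pclassK -[y]pclassK -raddfD !pscale_pclass.
by rewrite scalerDr raddfD.
Qed.
Lemma pscaleDl x : {morph pscale^~ x : a b / a + b}.
Proof. by move=> a b; rewrite -[x]pclassK !pscale_pclass scalerDl raddfD. Qed.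

HB.instance Definition _ :=
  GRing.Zmodule_isLmodule.Build K pres pscaleA pscale1 pscaleDr pscaleDl.

Lemma pclass_is_scalable : scalable pclass.
Proof. by move=> a x; rewrite -pscale_pclass. Qed.
HB.instance Definition _ :=
  GRing.isScalable.Build K {malg K[T]} pres _ pclass pclass_is_scalable.

Lemma prel r : R r -> pclass r = 0.
Proof.
move=> hr; apply/pclass_eq0; rewrite -[r]addr0 -[r in r + _]scale1r.
by apply: relspanD => //; constructor.
Qed.

Lemma pres_ind (P : pres -> Prop) :
    P 0 -> (forall a x y, P x -> P y -> P (a *: x + y)) ->
    (forall t, P (pgen t)) -> forall x, P x.
Proof.
move=> P0 PD Pg x; rewrite -[x]pclassK; move: (repr _) => {x} x.
rewrite (monalgE x) raddf_sum; elim/big_ind: _ => //.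
  by move=> y z hy hz; rewrite -[y]scale1r; apply: PD.
move=> t _; have -> : << x@_t *g t >> = x@_t *: << t >> :> {malg K[T]}.
  by apply/malgP => u; rewrite mcoeffZ !mcoeffU mulr_natr.
by rewrite /= linearZ -[X in P X]addr0; apply: PD => //; rewrite /= -pgenE; apply: Pg.
Qed.

Section Lift.
Variables (W : lmodType K) (f : T -> W).

Definition flift (x : {malg K[T]}) : W := \sum_(t <- msupp x) x@_t *: f t.

Lemma fliftEw (s : seq T) x :
  uniq s -> {subset msupp x <= s} -> flift x = \sum_(t <- s) x@_t *: f t.
Proof.
move=> us hs; rewrite [RHS](bigID (mem (msupp x))) /= [X in _ + X]big1 ?addr0.
  rewrite -big_filter /flift; apply: perm_big; apply: uniq_perm.
  - exact: fset_uniq.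
  - exact: filter_uniq.
  by move=> t; rewrite mem_filter; case h: (t \in _) => //=; rewrite hs.
by move=> t ht; rewrite mcoeff_outdom ?scale0r.
Qed.

Lemma flift_is_linear : linear flift.
Proof.
move=> a x y.
pose s := undup (msupp x ++ msupp y : seq T).
have us : uniq s by rewrite undup_uniq.
have hx : {subset msupp x <= s} by move=> t ht; rewrite mem_undup mem_cat ht.
have hy : {subset msupp y <= s}.
  by move=> t ht; rewrite mem_undup mem_cat ht orbT.
have hxy : {subset msupp (a *: x + y) <= s}.
  move=> t ht; case: (boolP (t \in s)) => // hn; move: ht.
  rewrite -mcoeff_neq0 mcoeffD mcoeffZ !mcoeff_outdom ?mulr0 ?addr0 ?eqxx //.
    exact: contra (hy t) hn.
  exact: contra (hx t) hn.
rewrite (fliftEw us hx) (fliftEw us hy) (fliftEw us hxy).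
rewrite scaler_sumr -big_split; apply: eq_bigr => t _ /=.
by rewrite mcoeffD mcoeffZ scalerDl scalerA.
Qed.
HB.instance Definition _ :=
  GRing.isLinear.Build K {malg K[T]} W _ flift flift_is_linear.

Lemma fliftU t : flift << t >> = f t.
Proof.
by rewrite /flift msuppU oner_eq0 big_seq_fset1 mcoeffUU scale1r.
Qed.

Definition respects := forall r, R r -> flift r = 0.

Definition plift of respects : pres -> W :=
  locked (fun x => flift (repr (x : {ideal_quot relsub}))).

Variable hf : respects.

Lemma plift_pclass x : plift hf (pclass x) = flift x.
Proof.
apply/eqP; rewrite -subr_eq0 /plift -lock -raddfB; apply/eqP.
have : relspan (repr (pclass x : {ideal_quot relsub}) - x).
  by apply/pclass_eq0; rewrite raddfB /= pclassK subrr.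
elim=> [|a r z hr _ IH]; first by rewrite raddf0.
by rewrite /= linearP /= IH hf // scaler0 addr0.
Qed.

Lemma plift_is_linear : linear (plift hf).
Proof.
move=> a x y; rewrite -[x]pclassK -[y]pclassK.
by rewrite -(linearP pclass) !plift_pclass linearP.
Qed.
HB.instance Definition _ :=
  GRing.isLinear.Build K pres W _ (plift hf) plift_is_linear.

Lemma plift_gen t : plift hf (pgen t) = f t.
Proof. by rewrite pgenE plift_pclass fliftU. Qed.
End Lift.
End Presented.

(* V = \bigoplus_k V^k; gpr k is the projection onto V^k.                     *)
Record graded (K : fieldType) := Graded {
  gcar :> lmodType K;
  gpr : int -> {linear gcar -> gcar};
  gprK : forall i j x, gpr i (gpr j x) = if i == j then gpr j x else 0;
  gpr_sum : forall x, exists2 s : seq int, uniq s & x = \sum_(k <- s) gpr k x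
}.
Arguments gpr {K V} k : rename.

Definition homog (K : fieldType) (V : graded K) (k : int) (x : V) :=
  gpr k x == x.

(* F^k V, k : int, a descending filtration by graded subspaces.               *)
Record filtration (K : fieldType) (V : graded K) := Filtration {
  fil_set :> int -> V -> Prop;
  fil0 : forall k, fil_set k 0;
  filP : forall k a x y,
    fil_set k x -> fil_set k y -> fil_set k (a *: x + y);
  fil_gpr : forall k i x, fil_set k x -> fil_set k (gpr i x);
  fil_decr : forall j k x, (j <= k)%R -> fil_set k x -> fil_set j x
}.

Record fgraded (K : fieldType) := FGraded {
  fgr :> graded K;
  fil : filtration fgr
}.
Arguments fil {K V} : rename.

(* V^k is the inverse limit of the V^k / F^n V^k, for every k.                *)
Definition complete (K : fieldType) (V : fgraded K) : Prop :=
  forall k : int,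
    (forall x : V, homog k x -> (forall n : nat, fil n%:Z x) -> x = 0) /\
    (forall u : nat -> V, (forall n, homog k (u n)) ->
       (forall n, fil n%:Z (u n.+1 - u n)) ->
       exists2 x : V, homog k x & forall n, fil n%:Z (x - u n)).

(* V[1]^k = V^(k+1), on the same underlying space.                            *)
Section Shift.
Variables (K : fieldType) (V : fgraded K).

Lemma shift_gprK (i j : int) (x : V) :
  gpr (i + 1) (gpr (j + 1) x) = if i == j then gpr (j + 1) x else 0.
Proof. by rewrite gprK (inj_eq (addIr 1)). Qed.

Lemma shift_gpr_sum (x : V) :
  exists2 s : seq int, uniq s & x = \sum_(k <- s) gpr (k + 1) x.
Proof.
have [s us {1}->] := gpr_sum x; exists [seq k - 1 | k <- s].
  by rewrite map_inj_uniq //; apply: addIr.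
by rewrite big_map; apply: eq_bigr => k _; rewrite subrK.
Qed.

Definition gshift : graded K :=
  @Graded K V (fun k => gpr (k + 1)) shift_gprK shift_gpr_sum.

Definition shift_filtration : filtration gshift :=
  @Filtration K gshift (fil (V := V)) (@fil0 _ _ fil) (@filP _ _ fil)
    (fun k i => @fil_gpr _ _ fil k (i + 1)) (@fil_decr _ _ fil).

Definition shift : fgraded K := FGraded shift_filtration.
End Shift.

Definition is_trivial (K : fieldType) (V : fgraded K) : Prop :=
  forall k (x : V), fil k x <-> (k <= 0)%R \/ x = 0.

(* A graded space without filtration is a graded space with this one: it is   *)
(* complete, and every linear map between the spaces V[1] and Sym(V[1])       *)
(* preserves it, by trivial_complete, trivial_shift, trivial_sym and          *)
(* trivial_preserved.                                                         *)
Section Trivial.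
Variables (K : fieldType) (V : graded K).

Definition trivial_set (k : int) (x : V) : Prop := (k <= 0)%R \/ x = 0.

Lemma trivial_setP k a x y :
  trivial_set k x -> trivial_set k y -> trivial_set k (a *: x + y).
Proof.
by move=> [|->]; [left|move=> [|->]; [left|right; rewrite scaler0 addr0]].
Qed.

Lemma trivial_set_gpr k i x : trivial_set k x -> trivial_set k (gpr i x).
Proof. by move=> [|->]; [left|right; rewrite raddf0]. Qed.

Lemma trivial_set_decr (j k : int) x :
  (j <= k)%R -> trivial_set k x -> trivial_set j x.
Proof. by move=> jk [h|->]; [left; apply: le_trans h|right]. Qed.

Definition trivial_filtration : filtration V :=
  Filtration (fun k => or_intror erefl) trivial_setP trivial_set_gpr
    trivial_set_decr.

Definition trivially_filtered : fgraded K := FGraded trivial_filtration.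

Lemma trivial_complete : complete trivially_filtered.
Proof.
move=> k; split=> [x _ /(_ 1%N) [] // | u hu hc].
exists (u 1%N) => // -[|n]; first by left.
right; suff -> : u n.+1 = u 1%N by rewrite subrr.
elim: n => // n IH; have [//|/eqP] := hc n.+1.
by rewrite subr_eq0 IH => /eqP.
Qed.

Lemma trivial_trivial : is_trivial trivially_filtered.
Proof. by []. Qed.
End Trivial.

Lemma trivial_shift (K : fieldType) (V : fgraded K) :
  is_trivial V -> is_trivial (shift V).
Proof. by []. Qed.

Lemma trivial_preserved (K : fieldType) (V W : fgraded K) (f : {linear V -> W}) :
  is_trivial V -> is_trivial W -> forall k x, fil k x -> fil k (f x).
Proof.
move=> hV hW k x /hV h; apply/hW.
by case: h => [|->]; [left|right; rewrite raddf0].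
Qed.

(* a homogeneous element, with its degree                                     *)
Definition letter (K : fieldType) (V : graded K) :=
  {p : int * V | homog p.1 p.2}.
Definition mk_letter (K : fieldType) (V : graded K) (d : int) (x : V)
  (h : homog d x) : letter V := exist _ (d, x) h.
Definition ldeg (K : fieldType) (V : graded K) (x : letter V) : int :=
  (val x).1.
Definition lval (K : fieldType) (V : graded K) (x : letter V) : V := (val x).2.

Section Words.
Variables (K : fieldType) (V : graded K).
Local Notation letterV := (letter V).
Definition wdeg (w : seq letterV) : int := \sum_(x <- w) ldeg x.

Inductive multilinear_rel : {malg K[seq letterV]} -> Prop :=
| MultilinearRel u v (a b c : letterV) (s : K) of
    ldeg a = ldeg c & ldeg b = ldeg c & lval c = s *: lval a + lval b :
    multilinear_rel
      (<< u ++ c :: v >> - (s *: << u ++ a :: v >> + << u ++ b :: v >>)).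

(* The last relator removes Sym^0.                                            *)
Inductive sym_rel : {malg K[seq letterV]} -> Prop :=
| SymMultilinear r of multilinear_rel r : sym_rel r
| SymSwap u v (x y : letterV) :
    sym_rel (<< u ++ x :: y :: v >>
             - (-1) ^ (ldeg x * ldeg y) *: << u ++ y :: x :: v >>)
| SymNil : sym_rel << [::] >>.

(* \bigoplus_(n >= 0) V^{\otimes n} *)
Definition tens := pres multilinear_rel.
Definition tword : seq letterV -> tens := @pgen _ _ multilinear_rel.

(* \bigoplus_(n >= 1) Sym^n V; symw [:: x1; ...; xn] is x1 \vee ... \vee xn   *)
Definition symcar := pres sym_rel.
Definition symw : seq letterV -> symcar := @pgen _ _ sym_rel.

Lemma tword_eq u v (a b c : letterV) s :
  ldeg a = ldeg c -> ldeg b = ldeg c -> lval c = s *: lval a + lval b ->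
  tword (u ++ c :: v) = s *: tword (u ++ a :: v) + tword (u ++ b :: v).
Proof.
move=> ha hb hc; apply/eqP; rewrite -subr_eq0; apply/eqP.
have := prel (MultilinearRel u v ha hb hc).
by rewrite linearB linearP /= /tword !pgenE.
Qed.

Lemma symw_eq u v (a b c : letterV) s :
  ldeg a = ldeg c -> ldeg b = ldeg c -> lval c = s *: lval a + lval b ->
  symw (u ++ c :: v) = s *: symw (u ++ a :: v) + symw (u ++ b :: v).
Proof.
move=> ha hb hc; apply/eqP; rewrite -subr_eq0; apply/eqP.
have := prel (SymMultilinear (MultilinearRel u v ha hb hc)).
by rewrite linearB linearP /= /symw !pgenE.
Qed.

Lemma symw_swap u v (x y : letterV) :
  symw (u ++ x :: y :: v) =
  (-1) ^ (ldeg x * ldeg y) *: symw (u ++ y :: x :: v).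
Proof.
apply/eqP; rewrite -subr_eq0; apply/eqP.
have := prel (SymSwap u v x y).
by rewrite linearB linearZ /= /symw !pgenE.
Qed.

Lemma symw_nil : symw [::] = 0.
Proof. by rewrite /symw pgenE; apply: prel SymNil. Qed.

Section WordLift.
Variables (W : lmodType K) (f : seq letterV -> W).

Definition multilinear := forall u v (a b c : letterV) s,
  ldeg a = ldeg c -> ldeg b = ldeg c -> lval c = s *: lval a + lval b ->
  f (u ++ c :: v) = s *: f (u ++ a :: v) + f (u ++ b :: v).

Definition graded_symmetric := forall u v (x y : letterV),
  f (u ++ x :: y :: v) = (-1) ^ (ldeg x * ldeg y) *: f (u ++ y :: x :: v).

Hypothesis fM : multilinear.

Lemma multilinear_respects : respects (@multilinear_rel) f.
Proof.
move=> _ [u v a b c s ha hb hc].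
by rewrite linearB linearP /= !fliftU (fM u v ha hb hc) subrr.
Qed.

Definition tlift : {linear tens -> W} := plift multilinear_respects.

Lemma tliftE w : tlift (tword w) = f w.
Proof. exact: plift_gen. Qed.

Hypotheses (fS : graded_symmetric) (f0 : f [::] = 0).

Lemma symmetric_respects : respects (@sym_rel) f.
Proof.
move=> _ [r hr|u v x y|]; first exact: multilinear_respects.
  by rewrite linearB linearZ /= !fliftU fS subrr.
by rewrite fliftU.
Qed.

Definition slift : {linear symcar -> W} := plift symmetric_respects.

Lemma sliftE w : slift (symw w) = f w.
Proof. exact: plift_gen. Qed.
End WordLift.

Lemma wdeg_cat u v : wdeg (u ++ v) = wdeg u + wdeg v.
Proof. exact: big_cat. Qed.

Lemma wdeg_cons x w : wdeg (x :: w) = ldeg x + wdeg w.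
Proof. exact: big_cons. Qed.
Lemma wdeg_nil : wdeg [::] = 0.
Proof. exact: big_nil. Qed.

(* The restriction of the identity to the span of the words satisfying P.     *)
Section Restrict.
Variable P : seq letterV -> bool.
Hypothesis PM : forall u v (a b : letterV),
  ldeg a = ldeg b -> P (u ++ a :: v) = P (u ++ b :: v).
Hypothesis PS : forall u v (x y : letterV),
  P (u ++ x :: y :: v) = P (u ++ y :: x :: v).

Let f w := if P w then symw w else 0.

Lemma restrictM : multilinear f.
Proof.
move=> u v a b c s ha hb hc; rewrite /f (PM u v ha) (PM u v hb).
by case: (P _); [exact: symw_eq | rewrite scaler0 addr0].
Qed.

Lemma restrictS : graded_symmetric f.
Proof.
move=> u v x y; rewrite /f (PS u v x y).
by case: (P _); [exact: symw_swap | rewrite scaler0].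
Qed.

Lemma restrict0 : f [::] = 0.
Proof. by rewrite /f symw_nil; case: (P _). Qed.

Definition restrict : {linear symcar -> symcar} :=
  slift restrictM restrictS restrict0.

Lemma restrictE w : restrict (symw w) = if P w then symw w else 0.
Proof. exact: sliftE. Qed.
End Restrict.

Lemma wdegM k u v (a b : letterV) : ldeg a = ldeg b ->
  (wdeg (u ++ a :: v) == k) = (wdeg (u ++ b :: v) == k).
Proof. by move=> h; rewrite !wdeg_cat !wdeg_cons h. Qed.

Lemma wdegS k u v (x y : letterV) :
  (wdeg (u ++ x :: y :: v) == k) = (wdeg (u ++ y :: x :: v) == k).
Proof. by rewrite !wdeg_cat !wdeg_cons [ldeg x + (_ + _)]addrCA. Qed.

Definition sym_gpr (k : int) : {linear symcar -> symcar} :=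
  @restrict (fun w => wdeg w == k) (@wdegM k) (@wdegS k).

Lemma sym_gprE k w : sym_gpr k (symw w) = if wdeg w == k then symw w else 0.
Proof. exact: restrictE. Qed.

Lemma sym_gprK i j x :
  sym_gpr i (sym_gpr j x) = if i == j then sym_gpr j x else 0.
Proof.
elim/pres_ind: x => [|a x y hx hy|w]; first by rewrite !raddf0; case: ifP.
  by rewrite !linearP hx hy; case: ifP; rewrite // scaler0 addr0.
rewrite -/(symw w) sym_gprE; case: ifP => [/eqP <-|hj].
  by rewrite sym_gprE eq_sym.
by rewrite raddf0; case: ifP.
Qed.

Lemma sym_gpr_sum x :
  exists2 s : seq int, uniq s & x = \sum_(k <- s) sym_gpr k x.
Proof.
have aux s t y : uniq s -> uniq t -> {subset s <= t} ->
    y = \sum_(k <- s) sym_gpr k y -> y = \sum_(k <- t) sym_gpr k y.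
  move=> us ut st ey; rewrite {1}ey [RHS](bigID (mem s)) /=.
  rewrite [X in _ + X]big1 ?addr0.
    rewrite -[RHS]big_filter; apply: perm_big; apply: uniq_perm => //.
      exact: filter_uniq.
    by move=> k; rewrite mem_filter; case h: (k \in s) => //=; rewrite st.
  move=> k ks; rewrite ey raddf_sum big1_seq // => j /andP[_ js].
  by rewrite /= sym_gprK; case: eqP ks js => // -> /negP.
elim/pres_ind: x => [|a x y [s us es] [t ut et]|w].
- by exists [::]; rewrite ?big_nil.
- exists (undup (s ++ t)); first exact: undup_uniq.
  have us' : uniq (undup (s ++ t)) by exact: undup_uniq.
  have hs : {subset s <= undup (s ++ t)}.
    by move=> k hk; rewrite mem_undup mem_cat hk.
  have ht : {subset t <= undup (s ++ t)}.
    by move=> k hk; rewrite mem_undup mem_cat hk orbT.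
  rewrite {1}(aux _ _ x us us' hs es) {1}(aux _ _ y ut us' ht et).
  by rewrite scaler_sumr -big_split; apply: eq_bigr => k _; rewrite linearP.
- exists [:: wdeg w] => //; rewrite big_seq1 -/(symw w).
  by rewrite sym_gprE eqxx.
Qed.

Definition sym : graded K := Graded sym_gprK sym_gpr_sum.

Lemma symw_homog w : homog (wdeg w) (symw w : sym).
Proof. by rewrite /homog /= sym_gprE eqxx. Qed.

Definition sletter (w : seq letterV) : letter sym :=
  mk_letter (symw_homog w).

(* the projection onto Sym^n V                                                *)
Lemma wlenM n u v (a b : letterV) : ldeg a = ldeg b ->
  (size (u ++ a :: v) == n) = (size (u ++ b :: v) == n).
Proof. by rewrite !size_cat. Qed.

Lemma wlenS n u v (x y : letterV) :
  (size (u ++ x :: y :: v) == n) = (size (u ++ y :: x :: v) == n).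
Proof. by rewrite !size_cat. Qed.

Definition sym_wpr (n : nat) : {linear sym -> sym} :=
  @restrict (fun w => size w == n) (@wlenM n) (@wlenS n).

(* \vee : V^{\otimes n} -> Sym^n V                                            *)
Definition vee : {linear tens -> sym} := tlift symw_eq.

(* V = Sym^1 V, extended by 0                                                 *)
Definition corestr_fun (w : seq letterV) : V :=
  if w is [:: x] then lval x else 0.

Lemma corestrM : multilinear corestr_fun.
Proof.
move=> [|y [|z u]] [|x v] a b c s ha hb hc //=; rewrite ?scaler0 ?addr0 //.
Qed.

Lemma corestrS : graded_symmetric corestr_fun.
Proof. by move=> [|z [|t u]] [|w v] x y /=; rewrite ?scaler0. Qed.

Definition corestr : {linear sym -> V} := slift corestrM corestrS erefl.
End Words.

Section WordLemmas.
Variables (K : fieldType) (V : graded K).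
Implicit Types (u v : seq (letter V)) (a b x : letter V).

Lemma tword0 u v x : lval x = 0 -> tword (u ++ x :: v) = 0.
Proof.
move=> hx; apply/eqP; rewrite -(inj_eq (addrI (tword (u ++ x :: v)))) addr0.
rewrite -[X in X + _]scale1r -(tword_eq u v (s := 1) erefl erefl) //.
by rewrite hx scaler0 addr0.
Qed.

Lemma twordZ u v a b (e : K) : ldeg a = ldeg b ->
  lval a = e *: lval b -> tword (u ++ a :: v) = e *: tword (u ++ b :: v).
Proof.
move=> hd hv.
pose z : letter V := mk_letter (introT eqP (raddf0 (gpr (ldeg a)))).
rewrite (tword_eq u v (a := b) (b := z) (s := e)) // ?addr0 //.
by rewrite [X in _ + X]tword0 ?addr0.
Qed.
End WordLemmas.

Section Coproduct.
Variables (K : fieldType) (V : graded K).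
Implicit Types (u v w l r : seq (letter V)) (x y : letter V).

(* All (e, l, r) such that, up to the Koszul sign (-1)^e, l followed by r is  *)
(* an unshuffle of w: a letter sent to r passes the letters after it in l.    *)
Fixpoint unshuffles w : seq (int * seq (letter V) * seq (letter V)) :=
  if w is x :: w' then
    flatten [seq [:: (p.1.1, x :: p.1.2, p.2);
                     (p.1.1 + ldeg x * wdeg p.1.2, p.1.2, x :: p.2)]
            | p <- unshuffles w']
  else [:: (0, [::], [::])].

Definition unshuffle_sum (W : lmodType K)
    (g : seq (letter V) -> seq (letter V) -> W) w : W :=
  \sum_(p <- unshuffles w) (-1) ^ p.1.1 *: g p.1.2 p.2.

Section UnshuffleSum.
Variable W : lmodType K.
Implicit Type g : seq (letter V) -> seq (letter V) -> W.

Lemma signD (m n : int) : (-1) ^ (m + n) = (-1) ^ m * (-1) ^ n :> K.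
Proof. by rewrite exprzDr ?unitrN1. Qed.

Lemma signK (m : int) : (-1) ^ m * (-1) ^ m = 1 :> K.
Proof. by rewrite -exprzMl ?unitrN1 // mulrNN mulr1 exp1rz. Qed.

Let step x g l r := g (x :: l) r + (-1) ^ (ldeg x * wdeg l) *: g l (x :: r).

Lemma unshuffle_sum_cons g x w :
  unshuffle_sum g (x :: w) = unshuffle_sum (step x g) w.
Proof.
rewrite /unshuffle_sum /= big_flatten big_map; apply: eq_bigr => p _.
by rewrite big_cons big_seq1 /= scalerDr scalerA signD.
Qed.

Definition bimultilinear g :=
  (forall r, multilinear (g^~ r)) /\ (forall l, multilinear (g l)).
Definition bisymmetric g :=
  (forall r, graded_symmetric (g^~ r)) /\ (forall l, graded_symmetric (g l)).

Lemma stepM x g : bimultilinear g -> bimultilinear (step x g).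
Proof.
move=> [g1 g2]; split=> [r|l] u v a b c s ha hb hc; rewrite /step.
  rewrite -![x :: u ++ _]cat_cons (g1 _ (x :: u) v _ _ _ _ ha hb hc).
  rewrite (g1 _ u v _ _ _ _ ha hb hc) !wdeg_cat !wdeg_cons ha hb.
  by rewrite !scalerDr !scalerA [s * _]mulrC addrACA.
rewrite -![x :: u ++ _]cat_cons (g2 _ (x :: u) v _ _ _ _ ha hb hc).
rewrite (g2 _ u v _ _ _ _ ha hb hc).
by rewrite !scalerDr !scalerA [s * _]mulrC addrACA.
Qed.

Lemma stepS z g : bisymmetric g -> bisymmetric (step z g).
Proof.
move=> [g1 g2]; split=> [r|l] u v x y; rewrite /step.
  rewrite -![z :: u ++ _]cat_cons (g1 _ (z :: u) v) (g1 _ u v).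
  rewrite !wdeg_cat !wdeg_cons [ldeg x + (_ + _)]addrCA.
  by rewrite scalerDr !scalerA [X in _ + X *: _]mulrC.
rewrite -![z :: u ++ _]cat_cons (g2 _ (z :: u) v) (g2 _ u v).
by rewrite scalerDr !scalerA [X in _ + X *: _]mulrC.
Qed.

Lemma unshuffle_sumM g : bimultilinear g -> multilinear (unshuffle_sum g).
Proof.
move=> gM u; elim: u g gM => [|x u IH] g gM v a b c s ha hb hc; last first.
  by rewrite /= !unshuffle_sum_cons; apply: IH => //; apply: stepM.
rewrite /= !unshuffle_sum_cons /unshuffle_sum scaler_sumr -big_split.
apply: eq_bigr => p _ /=; case: gM => g1 g2; rewrite /step.
rewrite (g1 _ [::] _ _ _ _ _ ha hb hc) (g2 _ [::] _ _ _ _ _ ha hb hc) ha hb.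
rewrite /= !scalerDr !scalerA addrACA.
by rewrite (mulrC _ s) [_ * _ * s]mulrC.
Qed.

Lemma unshuffle_sumS g : bisymmetric g -> graded_symmetric (unshuffle_sum g).
Proof.
move=> gS u; elim: u g gS => [|z u IH] g gS v x y; last first.
  by rewrite /= !unshuffle_sum_cons; apply: IH; apply: stepS.
rewrite /= !unshuffle_sum_cons /unshuffle_sum scaler_sumr.
apply: eq_bigr => p _ /=; rewrite scalerA mulrC -scalerA; congr (_ *: _).
case: gS => g1 g2; rewrite /step (g1 _ [::]) (g2 _ [::]) /= !wdeg_cons.
rewrite !mulrDr !signD [ldeg y * ldeg x]mulrC !scalerDr !scalerA.
set e := (-1) ^ (ldeg x * ldeg y); set ex := (-1) ^ _; set ey := (-1) ^ _.
rewrite -!addrA; congr (_ + _); rewrite addrCA.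
congr (_ + (_ + _)); congr (_ *: _).
by rewrite mulrA signK mul1r.
by rewrite [ey * ex]mulrC mulrAC [ex * e]mulrC.
Qed.
End UnshuffleSum.

Lemma sletterM : bimultilinear
  (fun l r => tword [:: sletter l; sletter r]).
Proof.
have hd u v (a b : letter V) : ldeg a = ldeg b ->
    ldeg (sletter (u ++ a :: v) : letter (sym V)) =
    ldeg (sletter (u ++ b :: v) : letter (sym V)).
  by move=> h; rewrite /ldeg /= !wdeg_cat !wdeg_cons h.
split=> [r|l] u v a b c s ha hb hc.
  apply: (tword_eq [::]); [exact: hd|exact: hd|exact: symw_eq].
apply: (tword_eq [:: _] [::]); [exact: hd|exact: hd|exact: symw_eq].
Qed.

Lemma sletterS : bisymmetric
  (fun l r => tword [:: sletter l; sletter r]).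
Proof.
have hd u v x y : ldeg (sletter (u ++ x :: y :: v) : letter (sym V)) =
    ldeg (sletter (u ++ y :: x :: v) : letter (sym V)).
  by rewrite /ldeg /= !wdeg_cat !wdeg_cons [_.1 + (_ + _)]addrCA.
split=> [r|l] u v x y.
  by apply: (twordZ [::]); [exact: hd|exact: symw_swap].
by apply: (twordZ [:: _] [::]); [exact: hd|exact: symw_swap].
Qed.

Lemma coproduct_nil : unshuffle_sum
  (fun l r => tword [:: sletter l; sletter r]) [::] = 0.
Proof.
rewrite /unshuffle_sum big_seq1 /= (@tword0 K (sym V) [::]) ?scaler0 //.
exact: symw_nil.
Qed.
End Coproduct.

(* \overline\Delta. The unshuffles with an empty part contribute 0, because   *)
(* symw [::] = 0.                                                             *)
Definition coproduct (K : fieldType) (V : graded K) :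
    {linear sym V -> tens (sym V)} :=
  slift (unshuffle_sumM (@sletterM K V)) (unshuffle_sumS (@sletterS K V))
    (@coproduct_nil K V).
Arguments coproduct {K} V.

Lemma coproductE (K : fieldType) (V : graded K) (w : seq (letter V)) :
  coproduct V (symw w) =
  \sum_(p <- unshuffles w)
     (-1) ^ p.1.1 *: tword [:: sletter p.1.2; sletter p.2].
Proof. exact: sliftE. Qed.

Section IteratedCoproduct.
Variable K : fieldType.

Section OnFirst.
Variable W : graded K.

Lemma tcatM (v : seq (letter W)) : multilinear (fun u => tword (u ++ v)).
Proof.
by move=> u u' a b c s ha hb hc; rewrite -!catA !cat_cons; apply: tword_eq.
Qed.

(* t |-> t \otimes v *)
Definition tcat (v : seq (letter W)) : {linear tens W -> tens W} :=
  tlift (tcatM v).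

Lemma tcatE v u : tcat v (tword u) = tword (u ++ v).
Proof. exact: tliftE. Qed.

Lemma tcat_multilinear t : multilinear (fun v => tcat v t).
Proof.
move=> u v a b c s ha hb hc; elim/pres_ind: t => [|e y z hy hz|w].
- by rewrite !raddf0 addr0.
- rewrite (linearP (tcat (u ++ c :: v))) (linearP (tcat (u ++ a :: v))).
  rewrite (linearP (tcat (u ++ b :: v))) hy hz !scalerDr !scalerA addrACA [s * e]mulrC.
  by congr (_ + _); rewrite !addrA.
by rewrite -/(tword w) !tcatE !catA; apply: tword_eq.
Qed.

Variable D : {linear W -> tens W}.

Definition on_first_fun (w : seq (letter W)) : tens W :=
  if w is x :: v then tcat v (D (lval x)) else 0.

Lemma on_firstM : multilinear on_first_fun.
Proof.
move=> [|x u] v a b c s ha hb hc /=; first by rewrite hc !linearP.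
exact: tcat_multilinear.
Qed.

(* D \otimes id \otimes ... \otimes id, for D of degree 0 *)
Definition on_first : {linear tens W -> tens W} := tlift on_firstM.
End OnFirst.

Variable V : graded K.

Lemma coproduct0M :
  multilinear (fun w : seq (letter V) => tword [:: sletter w]).
Proof.
move=> u v a b c s ha hb hc.
by apply: (tword_eq [::]); [rewrite /ldeg /= !wdeg_cat !wdeg_cons ?ha ?hb..
                            |exact: symw_eq].
Qed.

Lemma coproduct0S :
  graded_symmetric (fun w : seq (letter V) => tword [:: sletter w]).
Proof.
move=> u v x y; apply: (twordZ [::]); last exact: symw_swap.
by rewrite /ldeg /= !wdeg_cat !wdeg_cons [_.1 + (_ + _)]addrCA.
Qed.

Lemma coproduct0_nil : tword [:: sletter ([::] : seq (letter V))] = 0.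
Proof. by apply: (@tword0 K (sym V) [::]); apply: symw_nil. Qed.

(* \overline\Delta^n, with values in n + 1 tensor factors                     *)
Fixpoint coproduct_iter (n : nat) : {linear sym V -> tens (sym V)} :=
  if n is m.+1 then on_first (coproduct V) \o coproduct_iter m
  else slift coproduct0M coproduct0S coproduct0_nil.
End IteratedCoproduct.

Section SymFiltration.
Variables (K : fieldType) (V : fgraded K).

(* x1 \vee ... \vee xn lies in F^k if xi lies in F^(ki) and k <= sum of ki.   *)
Inductive word_fil : int -> seq (letter V) -> Prop :=
| word_fil_nil k of (k <= 0)%R : word_fil k [::]
| word_fil_cons j k x w of fil j (lval x) & word_fil k w :
    word_fil (j + k) (x :: w).

Inductive sym_fil (k : int) : sym V -> Prop :=
| sym_fil0 : sym_fil k 0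
| sym_filD a w y of word_fil k w & sym_fil k y :
    sym_fil k (a *: (symw w : sym V) + y).

Lemma sym_filP k a x y : sym_fil k x -> sym_fil k y -> sym_fil k (a *: x + y).
Proof.
move=> hx hy; elim: hx => [|b w z hw _ IH]; first by rewrite scaler0 add0r.
by rewrite scalerDr scalerA -addrA; apply: sym_filD.
Qed.

Lemma sym_fil_gpr k i x : sym_fil k x -> sym_fil k (gpr i x).
Proof.
elim=> [|b w z hw _ IH]; first by rewrite raddf0; constructor.
rewrite linearP /= sym_gprE; case: ifP => _; first exact: sym_filD.
by rewrite scaler0 add0r.
Qed.

Lemma word_fil_decr j k w : (j <= k)%R -> word_fil k w -> word_fil j w.
Proof.
move=> jk hw; elim: hw j jk => [{}k hk|i {}k x {}w hx _ IH] j jk.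
  by constructor; apply: le_trans hk.
rewrite -[j](subrKC i); constructor=> //; apply: IH.
by rewrite lerBlDl.
Qed.

Lemma sym_fil_decr j k x : (j <= k)%R -> sym_fil k x -> sym_fil j x.
Proof.
move=> jk; elim=> [|b w z hw _ IH]; first by constructor.
by apply: sym_filD => //; apply: word_fil_decr hw.
Qed.

Definition sym_filtration : filtration (sym V) :=
  Filtration sym_fil0 sym_filP sym_fil_gpr sym_fil_decr.

Definition fsym : fgraded K := FGraded sym_filtration.

Lemma trivial_sym : is_trivial V -> is_trivial fsym.
Proof.
move=> hV k x; split; last first.
  move=> [hk|->]; last exact: fil0.
  apply: (fil_decr hk); elim/pres_ind: x => [|a y z hy hz|w].
  - exact: sym_fil0.
  - exact: sym_filP.
  rewrite -/(symw w) -[symw w]addr0 -[symw w]scale1r.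
  apply: sym_filD; last exact: sym_fil0.
  elim: w => [|y w IH]; first by constructor.
  by rewrite -[0]addr0; constructor=> //; apply/hV; left.
have aux j w : word_fil j w -> (j <= 0)%R \/ forall u, symw (u ++ w) = 0.
  elim=> {j w} [j|j i y w /hV hy _ IH]; first by left.
  case: hy IH => [hj|hy]; last first.
    by move=> _; right=> u; rewrite (symw_eq u w (s := -1) (a := y) (b := y))
      ?scaleN1r ?addNr // hy oppr0 addr0.
  case=> [hk|hw]; [left|right=> u]; last by rewrite -cat_rcons.
  by rewrite -[0]addr0 lerD.
elim=> [|a w y hw _ IH]; first by right.
case: (aux _ _ hw) => [hk|/(_ [::]) /= ->]; first by left.
by case: IH => [|->]; [left|right; rewrite scaler0 addr0].
Qed.
End SymFiltration.

(* degree d, compatible with the filtrations                                  *)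
Record ghom (K : fieldType) (d : int) (V W : fgraded K) := GHom {
  gfun :> {linear V -> W};
  ghom_deg : forall k x, homog k x -> homog (k + d) (gfun x);
  ghom_fil : forall k x, fil k x -> fil k (gfun x)
}.

Section GHom.
Variable K : fieldType.
Implicit Types U V W : fgraded K.

Lemma gid_deg V k (x : V) : homog k x -> homog (k + 0) x.
Proof. by rewrite addr0. Qed.

Definition gid V : ghom 0 V V :=
  @GHom K 0 V V (idfun : {linear V -> V}) (@gid_deg V) (fun _ _ h => h).

Lemma gcomp0_deg U V W d (f : ghom d V W) (g : ghom 0 U V) k x :
  homog k x -> homog (k + d) (f (g x)).
Proof. by move=> /(ghom_deg g); rewrite addr0; apply: ghom_deg. Qed.

Definition gcomp0 U V W d (f : ghom d V W) (g : ghom 0 U V) : ghom d U W :=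
  @GHom K d U W (f \o g : {linear U -> W}) (gcomp0_deg f g)
    (fun k x h => ghom_fil f (ghom_fil g h)).

(* a homogeneous linear map, with its degree                                  *)
Definition hmap V W := {d : int & ghom d V W}.
Definition mk_hmap V W d (f : ghom d V W) : hmap V W :=
  Tagged (fun e => ghom e V W) f.

Definition hmap_letter V W (f : hmap V W) (x : letter V) : letter W :=
  mk_letter (ghom_deg (tagged f) (valP x)).

Section TensorMap.
Variables V W : fgraded K.
Implicit Types (fs : seq (hmap V W)) (w : seq (letter V)).

(* (f1 \otimes ... \otimes fn)(x1 \otimes ... \otimes xn) has the sign        *)
(* (-1)^e, e the sum of the |fj| |xi| for i < j.                              *)
Fixpoint tensor_exp fs w : int :=
  match fs, w with
  | f :: fs', x :: w' => ldeg x * (\sum_(g <- fs') tag g) + tensor_exp fs' w'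
  | _, _ => 0
  end.

Definition tensor_word fs w : seq (letter W) :=
  [seq hmap_letter p.1 p.2 | p <- zip fs w].

Definition tensor_map_fun fs w : tens W :=
  if size w == size fs then
    (-1) ^ tensor_exp fs w *: tword (tensor_word fs w)
  else 0.

Lemma tensor_expM fs u v (a b : letter V) : ldeg a = ldeg b ->
  tensor_exp fs (u ++ a :: v) = tensor_exp fs (u ++ b :: v).
Proof.
by move=> h; elim: fs u => [|f fs IH] [|x u] //=; rewrite ?h ?IH.
Qed.

Lemma tensor_mapM fs : multilinear (tensor_map_fun fs).
Proof.
move=> u v a b c s ha hb hc; rewrite /tensor_map_fun !size_cat /=.
case: eqP => [hs|_]; last by rewrite scaler0 addr0.
rewrite (tensor_expM fs u v ha) (tensor_expM fs u v hb) scalerA mulrC -scalerA.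
rewrite -scalerDr; congr (_ *: _); rewrite /tensor_word.
have {}hs : (size u < size fs)%N by rewrite -hs addnS ltnS leq_addr.
have [f hf] : exists f, drop (size u) fs = f :: drop (size u).+1 fs.
  case: fs hs => [|f fs] // hs.
  by exists (nth f (f :: fs) (size u)); rewrite (drop_nth f).
rewrite -(cat_take_drop (size u) fs) hf.
rewrite !zip_cat ?size_take ?hs // !map_cat /=; apply: tword_eq.
- by rewrite /ldeg /= -/(ldeg a) -/(ldeg c) ha.
- by rewrite /ldeg /= -/(ldeg b) -/(ldeg c) hb.
by rewrite /lval /= -/(lval c) hc linearP.
Qed.

Definition tensor_map fs : {linear tens V -> tens W} := tlift (tensor_mapM fs).
End TensorMap.
End GHom.

Record linf (K : fieldType) := LInf {
  lspace :> fgraded K;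
  lcomplete : complete lspace;
  lQ : ghom 1 (fsym (shift lspace)) (fsym (shift lspace));
  lQ_coderivation : forall x,
    coproduct (shift lspace) (lQ x) =
      tensor_map [:: mk_hmap lQ; mk_hmap (gid _)] (coproduct _ x) +
      tensor_map [:: mk_hmap (gid _); mk_hmap lQ] (coproduct _ x);
  lQ2 : forall x, lQ (lQ x) = 0
}.
Arguments lQ {K} L : rename.

Record linf_mor (K : fieldType) (L L' : linf K) := LInfMor {
  lmor :> ghom 0 (fsym (shift L)) (fsym (shift L'));
  lmor_coalgebra : forall x,
    coproduct (shift L') (lmor x) =
      tensor_map [:: mk_hmap lmor; mk_hmap lmor] (coproduct (shift L) x);
  lmorQ : forall x, lmor (lQ L x) = lQ L' (lmor x)
}.

Section Composition.
Variables (K : fieldType) (L L' L'' : linf K).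
Variables (F : linf_mor L L') (H : linf_mor L'' L).

Lemma tensor_map_comp2 (U V W : fgraded K) (f : ghom 0 V W) (g : ghom 0 U V) t :
  tensor_map [:: mk_hmap f; mk_hmap f]
    (tensor_map [:: mk_hmap g; mk_hmap g] t) =
  tensor_map [:: mk_hmap (gcomp0 f g); mk_hmap (gcomp0 f g)] t.
Proof.
elim/pres_ind: t => [|a x y hx hy|w]; first by rewrite !raddf0.
  by rewrite !linearP hx hy.
rewrite -/(tword w) !tliftE /tensor_map_fun; case: w => [|x [|y [|z w]]] /=;
  rewrite ?raddf0 // !big_seq1 !big_nil /= !mulr0 !addr0 !expr0z !scale1r.
rewrite !tliftE /tensor_map_fun /= !big_seq1 !big_nil /= !mulr0 !addr0 !expr0z !scale1r.
by congr (tword [:: _; _]); apply: val_inj; rewrite /= /ldeg /= !addr0.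
Qed.

Lemma linf_comp_coalgebra x :
  coproduct (shift L') (gcomp0 F H x) =
  tensor_map [:: mk_hmap (gcomp0 F H); mk_hmap (gcomp0 F H)]
    (coproduct (shift L'') x).
Proof. by rewrite /= !lmor_coalgebra tensor_map_comp2. Qed.

Lemma linf_compQ x : gcomp0 F H (lQ L'' x) = lQ L' (gcomp0 F H x).
Proof. by rewrite /= !lmorQ. Qed.

Definition linf_comp : linf_mor L'' L' :=
  LInfMor linf_comp_coalgebra linf_compQ.
End Composition.

Section Convolution.
Variables (K : fieldType) (L L' : linf K).

Local Notation S := (fsym (shift L)).
Local Notation T := (shift L').

(* the component P^1_n of P, extended by 0 to the Sym^m with m != n           *)
Definition component (V W : graded K) (P : {linear sym V -> sym W}) (n : nat)
    (x : sym V) : W := corestr W (P (sym_wpr V n x)).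

(* \mathcal H[1]^d *)
Definition conv (d : int) := ghom d S T.

(* \hat Q^1_n(f1 \vee ... \vee fn), n >= 1. For n = 1 the first term is       *)
(* Q'^1_1 \circ f1, since \overline\Delta^0 = id and \vee^0 = id.             *)
Definition conv_Q (fs : seq (hmap S T)) (x : S) : T :=
  component (lQ L') (size fs)
    (vee T (tensor_map fs (coproduct_iter (shift L) (size fs).-1 x)))
  - (if fs is [:: f] then (-1) ^ (tag f) *: tagged f (lQ L x) else 0).

(* f lies in \mathcal F^n \mathcal H                                          *)
Definition conv_fil (n : nat) (f : S -> T) : Prop :=
  forall w : seq (letter (shift L)), (size w < n)%N -> f (symw w) = 0.

Definition conv_lim (a : nat -> S -> T) (f : S -> T) : Prop :=
  forall n, exists N, forall m, (N <= m)%N -> conv_fil n (fun x => a m x - f x).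

(* F i is the coefficient of t^i in F(t)                                      *)
Definition poly_mod_fil (d : int) (F : nat -> conv d) : Prop :=
  forall n, exists N, forall i, (N <= i)%N -> conv_fil n (F i).

(* F(c) = f *)
Definition series_eval (d : int) (F : nat -> conv d) (c : K) (f : S -> T) :=
  conv_lim (fun m x => \sum_(i < m) c ^+ i *: F i x) f.

(* the coefficient of t^i in                                                  *)
(* \hat Q^1_(n+1)(\lambda(t) \vee F(t) \vee ... \vee F(t))                    *)
Definition conv_Q_coef (l : nat -> conv (-1)) (F : nat -> conv 0)
    (i n : nat) (x : S) : T :=
  \sum_(j : n.+1.-tuple 'I_i.+1 | (\sum_(a <- j) a == i)%N)
    conv_Q (mk_hmap (l (thead j)) ::
              [seq mk_hmap (F (nat_of_ord a)) | a <- behead j]) x.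

(* d/dt F(t) = \sum_n 1/n! \hat Q^1_(n+1)(\lambda(t) \vee F(t)^n), compared   *)
(* coefficientwise                                                            *)
Definition homotopy_ode (l : nat -> conv (-1)) (F : nat -> conv 0) : Prop :=
  forall i, conv_lim
    (fun m x => \sum_(n < m) (n`!%:R)^-1 *: conv_Q_coef l F i n x)
    (fun x => i.+1%:R *: F i.+1 x).

(* the Maurer--Cartan element identified with the morphism F                  *)
Definition mc_element (F : linf_mor L L') (x : S) : T := corestr T (F x).

Definition elementary_homotopic (F0 F1 : linf_mor L L') : Prop :=
  exists (F : nat -> conv 0) (l : nat -> conv (-1)),
    [/\ poly_mod_fil F, poly_mod_fil l, homotopy_ode l F,
        series_eval F 0 (mc_element F0) & series_eval F 1 (mc_element F1)].

Definition homotopic : linf_mor L L' -> linf_mor L L' -> Prop :=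
  clos_trans _ elementary_homotopic.
End Convolution.

(* Main.v *)
From HB Require Import structures.
Require Import Defs.
From mathcomp Require Import all_boot all_order all_algebra.
From Stdlib Require Import Relation_Operators.

(** Precomposition with the coalgebra morphism [H : Sym(L''[1]) -> Sym(L[1])]
    sends [f] in Hom(Sym(L[1]), L') to [f \o H] in Hom(Sym(L''[1]), L'), and
    this is a strict morphism of convolution L-infinity algebras.  Hence it
    carries a homotopy [(F(t), lambda(t))] to the homotopy
    [(F(t) H, lambda(t) H)], and the theorem follows by induction on the
    transitive closure.  Two facts make this work.

    The brackets are respected ([conv_Q_precomp]).  Since [H] is compatible with
    the binary coproduct, it is compatible with all the iterated ones
    ([coproduct_iter_map]); since it has degree 0, moving it through a tensor
    product of maps creates no sign ([tensor_map_precomp]).  The unary bracket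
    also needs [H] to commute with the codifferentials.

    The filtrations by weight are respected ([conv_fil_precomp]), which is what
    lets convergence and polynomiality modulo each step be transported.  This
    amounts to saying that [H] does not raise the number of letters of a word
    ([coalgebra_map_weight]), and it is the place where characteristic 0 enters.
    Let [D] split off one letter by the coproduct and multiply it back: on
    Sym^m with [m >= 2] it is multiplication by [m] ([vee_last_coproduct]).
    For a word [w] with fewer than [m] letters, the part of [D (H w)] in Sym^m
    is a sum of products of the part of [H l] in Sym^(m-1) with a letter, over
    proper subwords [l] of [w], so it vanishes by induction; dividing by [m]
    shows that [H w] has no part in Sym^m. *)

Set Implicit Arguments.
Unset Strict Implicit.
Unset Printing Implicit Defensive.

Import GRing.Theory.
Local Open Scope ring_scope.

(** * Unshuffles and the weight decomposition *)

Section Weight.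
Variables (K : fieldType) (V : graded K).
Implicit Types (w l r : seq (letter V)) (c : letter V).

Lemma sym_wprE n w :
  sym_wpr V n (symw w) = if size w == n then symw w else 0.
Proof. exact: restrictE. Qed.

Lemma sym_wpr_sum (x : sym V) :
  exists N, forall M, (N <= M)%N -> x = \sum_(m < M) sym_wpr V m x.
Proof.
elim/pres_ind: x => [|a x y [N hx] [N' hy]|w].
- by exists 0%N => M _; rewrite big1 // => m _; rewrite raddf0.
- exists (maxn N N') => M; rewrite geq_max => /andP[hN hN'].
  rewrite {1}(hx _ hN) {1}(hy _ hN') scaler_sumr -big_split.
  by apply: eq_bigr => m _; rewrite linearP.
exists (size w).+1 => M hM; rewrite -/(symw w) (bigD1 (Ordinal hM)) //=.
rewrite sym_wprE eqxx big1 ?addr0 // => m hm; rewrite sym_wprE.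
by case: eqP => // e; case/eqP: hm; apply: val_inj.
Qed.

(** The Koszul sign attached to an unshuffle is the one that sorts its two
    parts back into the original word. *)
Lemma unshuffles_symw w p : p \in unshuffles w ->
  forall u, (-1) ^ p.1.1 *: symw (u ++ p.1.2 ++ p.2) = symw (u ++ w).
Proof.
elim: w p => [|x w IH] p /=; first by rewrite inE => /eqP -> u; rewrite scale1r.
case/flatten_mapP=> q hq; rewrite !inE => /orP[] /eqP -> u /=.
  by rewrite -!cat_rcons IH.
rewrite -[in RHS]cat_rcons -(IH q hq) signD -scalerA; congr (_ *: _).
elim: q.1.2 u => [|y l IHl] u; first by rewrite wdeg_nil mulr0 scale1r cat_rcons.
rewrite wdeg_cons mulrDr signD cat_rcons /= symw_swap -!cat_rcons -scalerA.
by rewrite -IHl !cat_rcons !scalerA [_ * (-1) ^ _]mulrC.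
Qed.

Lemma unshuffles_size w p :
  p \in unshuffles w -> (size p.1.2 + size p.2)%N = size w.
Proof.
elim: w p => [|x w IH] p /=; first by rewrite inE => /eqP ->.
case/flatten_mapP=> q /IH hq; rewrite !inE => /orP[] /eqP -> /=.
  by rewrite addSn hq.
by rewrite addnS hq.
Qed.

Lemma unshuffles_count0 w :
  count (fun p => size p.2 == 0)%N (unshuffles w) = 1%N.
Proof.
elim: w => //= x w IH; rewrite count_flatten -map_comp -[RHS]IH.
by rewrite -sumn_count; congr sumn; apply: eq_map => p /=; rewrite !addn0.
Qed.

Lemma unshuffles_count1 w :
  count (fun p => size p.2 == 1)%N (unshuffles w) = size w.
Proof.
elim: w => //= x w IH; rewrite count_flatten -map_comp.
transitivity (count (fun p => size p.2 == 0)%N (unshuffles w)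
              + count (fun p => size p.2 == 1)%N (unshuffles w))%N; last first.
  by rewrite unshuffles_count0 IH.
rewrite -!sumn_count; elim: (unshuffles w) => //= p s ->.
by rewrite addn0 eqSS [((size _ == 1) + _)%N]addnC addnACA.
Qed.

Lemma coproduct_linear (W : lmodType K) (T : {linear tens (sym V) -> W}) w :
  T (coproduct V (symw w)) =
  \sum_(p <- unshuffles w)
     (-1) ^ p.1.1 *: T (tword [:: sletter p.1.2; sletter p.2]).
Proof.
by rewrite coproductE linear_sum; apply: eq_bigr => p _; rewrite linearZZ.
Qed.

(** * Splitting off one letter and multiplying it back *)

Section VeeLetter.
Variable c : letter V.

(** Right multiplication by [c].  The empty word must go to 0, and not to [c],
    for this to factor through the relation that removes Sym^0. *)
Definition vee_letter_fun w := if nilp w then 0 else symw (rcons w c).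

Lemma vee_letterM : multilinear vee_letter_fun.
Proof.
move=> u v a b e s ha hb hc.
by rewrite /vee_letter_fun /nilp !size_cat !addnS /= !rcons_cat; apply: symw_eq.
Qed.

Lemma vee_letterS : graded_symmetric vee_letter_fun.
Proof.
move=> u v x y.
by rewrite /vee_letter_fun /nilp !size_cat !addnS /= !rcons_cat; apply: symw_swap.
Qed.

Definition vee_letter : {linear symcar V -> symcar V} :=
  slift vee_letterM vee_letterS erefl.

Lemma vee_letterE w :
  vee_letter (symw w) = if nilp w then 0 else symw (rcons w c).
Proof. exact: sliftE. Qed.

Lemma sym_wpr_vee_letter n (x : sym V) :
  sym_wpr V n.+1 (vee_letter x) = vee_letter (sym_wpr V n x).
Proof.
elim/pres_ind: x => [|a x y hx hy|w]; first by rewrite !raddf0.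
  by rewrite !linearP hx hy.
rewrite -/(symw w) sym_wprE (fun_if vee_letter) vee_letterE raddf0.
case: ifP => _; first by rewrite raddf0; case: ifP.
by rewrite sym_wprE size_rcons.
Qed.
End VeeLetter.

Lemma vee_letter_lin (x : sym V) (a b c : letter V) s :
  ldeg a = ldeg c -> ldeg b = ldeg c -> lval c = s *: lval a + lval b ->
  vee_letter c x = s *: vee_letter a x + vee_letter b x.
Proof.
move=> ha hb hc; elim/pres_ind: x => [|e x y hx hy|w].
- by rewrite !raddf0 addr0.
- rewrite (linearP (vee_letter a)) (linearP (vee_letter b)).
  rewrite (linearP (vee_letter c)) hx hy !scalerDr !scalerA addrACA [s * e]mulrC.
  by congr (_ + _); rewrite !addrA.
rewrite -/(symw w) !vee_letterE; case: ifP => _; first by rewrite scaler0 addr0.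
by rewrite -!cats1; apply: symw_eq.
Qed.

Lemma vee_letter0 (c : letter V) (x : sym V) : lval c = 0 -> vee_letter c x = 0.
Proof.
(* 0 = - 0 + 0, so linearity gives vee_letter c = - vee_letter c + vee_letter c *)
by move=> hc; rewrite (@vee_letter_lin x c c c (-1)) ?scaleN1r ?addNr.
Qed.

Lemma corestr_homog (x : letter (sym V)) : homog (ldeg x) (corestr V (lval x)).
Proof.
have aux k (y : sym V) : gpr k (corestr V y) = corestr V (gpr k y).
  elim/pres_ind: y => [|a y z hy hz|w]; first by rewrite !raddf0.
    by rewrite !linearP hy hz.
  rewrite -/(symw w) /= sym_gprE (fun_if (corestr V)) raddf0 !sliftE.
  case: w => [|y [|z w]] /=; rewrite ?raddf0 ?if_same //.
  rewrite wdeg_cons wdeg_nil addr0; have /eqP hy := valP y.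
  by rewrite -[lval y]hy gprK eq_sym.
by rewrite /homog aux; case: x => -[k y] /= h; rewrite (eqP h).
Qed.

Definition corestr_letter (x : letter (sym V)) : letter V :=
  mk_letter (corestr_homog x).

(** The product of Sym, after projecting the second of two tensor factors to
    Sym^1. *)
Definition vee_last_fun (t : seq (letter (sym V))) : symcar V :=
  if t is [:: x; y] then vee_letter (corestr_letter y) (lval x) else 0.

Lemma vee_lastM : multilinear vee_last_fun.
Proof.
move=> [|x [|y [|z u]]] [|e [|f v]] a b c s ha hb hc //=;
  rewrite ?scaler0 ?addr0 //; first by rewrite hc linearP.
by apply: vee_letter_lin => //; rewrite /lval /= -!/(lval _) hc linearP.
Qed.

Definition vee_last : {linear tens (sym V) -> symcar V} := tlift vee_lastM.

Lemma vee_lastE t : vee_last (tword t) = vee_last_fun t.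
Proof. exact: tliftE. Qed.

(** The unshuffles that contribute are those whose second part is one letter.
    There are [size w] of them, and each gives back [symw w]; for a word of one
    letter the first part is empty and the product is 0. *)
Lemma vee_last_coproduct_symw w :
  vee_last (coproduct V (symw w)) =
  (if (1 < size w)%N then size w else 0%N)%:R *: symw w.
Proof.
rewrite coproduct_linear.
rewrite (eq_big_seq (fun p => if (size p.2 == 1)%N && (1 < size w)%N
                              then symw w else 0)).
  rewrite -big_mkcond /=; case: (1 < size w)%N; last first.
    by rewrite scale0r big_pred0 // => p; rewrite andbF.
  under eq_bigl do rewrite andbT.
  by rewrite big_const_seq unshuffles_count1 iter_addr addr0 scaler_nat.
move=> p hp; rewrite vee_lastE /=.
have := unshuffles_size hp; have := unshuffles_symw hp [::].
have hr r : lval (corestr_letter (sletter r)) = corestr_fun r by exact: sliftE.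
case: p {hp} => [[e l] r] /=; case: r => [|c [|d r]] /= hw hs.
- by rewrite vee_letter0 ?hr ?scaler0.
- have -> : corestr_letter (sletter [:: c]) = c.
    apply: val_inj; rewrite [LHS]surjective_pairing [RHS]surjective_pairing.
    congr (_, _); last exact: hr.
    by rewrite -[LHS]/(wdeg [:: c]) wdeg_cons wdeg_nil addr0.
  rewrite vee_letterE -hs addn1 ltnS lt0n -/(nilp l).
  case: (nilp l); first by rewrite scaler0.
  by rewrite -cats1.
by rewrite vee_letter0 ?hr ?scaler0.
Qed.

Lemma vee_last_coproduct n (x : sym V) :
  sym_wpr V n (vee_last (coproduct V x)) =
  (if (1 < n)%N then n else 0%N)%:R *: sym_wpr V n x.
Proof.
elim/pres_ind: x => [|a x y hx hy|w]; first by rewrite !raddf0.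
  rewrite (linearP (coproduct V)) (linearP vee_last) !(linearP (sym_wpr V n)).
  by rewrite /= hx hy scalerDr !scalerA mulrC.
rewrite -/(symw w) vee_last_coproduct_symw linearZ /= sym_wprE.
by case: eqP => [->|_] //; rewrite !scaler0.
Qed.
End Weight.

(** * Tensor powers of a degree 0 map *)

Section TensorPower.
Variable K : fieldType.

Section OneMap.
Variables (V W : fgraded K) (f : ghom 0 V W).

Definition map_word (w : seq (letter V)) : seq (letter W) :=
  [seq hmap_letter (mk_hmap f) x | x <- w].

Lemma map_wordM : multilinear (fun w => tword (map_word w)).
Proof.
move=> u v a b c s ha hb hc; rewrite /map_word !map_cat; apply: tword_eq.
- by rewrite /ldeg /= -!/(ldeg _) ha.
- by rewrite /ldeg /= -!/(ldeg _) hb.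
by rewrite /lval /= -!/(lval _) hc linearP.
Qed.

(** The direct sum of all the tensor powers of [f].  Not fixing the number of
    factors makes it commute with concatenation of tensors. *)
Definition tens_map : {linear tens V -> tens W} := tlift map_wordM.

Lemma tens_mapE w : tens_map (tword w) = tword (map_word w).
Proof. exact: tliftE. Qed.

Lemma tens_map_tcat v t :
  tens_map (tcat v t) = tcat (map_word v) (tens_map t).
Proof.
elim/pres_ind: t => [|a x y hx hy|w]; first by rewrite !raddf0.
  by rewrite !linearP hx hy.
by rewrite -/(tword w) tcatE !tens_mapE tcatE /map_word map_cat.
Qed.
End OneMap.

Definition precomp (U V W : fgraded K) (g : ghom 0 U V) (f : hmap V W) :
    hmap U W := mk_hmap (gcomp0 (tagged f) g).

(** No Koszul sign appears because [g] has degree 0. *)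
Lemma tensor_map_precomp (U V W : fgraded K) (g : ghom 0 U V)
    (fs : seq (hmap V W)) t :
  tensor_map (map (precomp g) fs) t = tensor_map fs (tens_map g t).
Proof.
elim/pres_ind: t => [|a x y hx hy|w]; first by rewrite !raddf0.
  by rewrite !linearP hx hy.
rewrite -/(tword w) tens_mapE !tliftE /tensor_map_fun !size_map.
case: eqP => // _; congr (_ ^ _ *: tword _).
  elim: fs w => [|f fs IH] [|x w] //=; rewrite IH big_map.
  by rewrite [X in _ = X * _ + _]addr0.
elim: fs w => [|f fs IH] [|x w] //=; rewrite /tensor_word /=.
congr (_ :: _); last exact: IH.
by apply: val_inj; rewrite /= /ldeg /= addr0.
Qed.

Variables (V W : fgraded K) (f : ghom 0 (Defs.fsym V) (Defs.fsym W)).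
Hypothesis f_coalgebra : forall x,
  coproduct W (f x) = tensor_map [:: mk_hmap f; mk_hmap f] (coproduct V x).

Lemma coproduct_map x : coproduct W (f x) = tens_map f (coproduct V x).
Proof.
rewrite f_coalgebra; elim/pres_ind: x => [|a x y hx hy|w].
- by rewrite !raddf0.
- by rewrite !linearP hx hy.
rewrite -/(symw w) !coproduct_linear; apply: eq_bigr => p _; congr (_ *: _).
rewrite [LHS]plift_gen tens_mapE /tensor_map_fun /=.
by rewrite !big_seq1 !big_nil !mulr0 !addr0 expr0z scale1r.
Qed.

(** * Coalgebra morphisms and iterated coproducts *)

Lemma coproduct_iter0E (U : graded K) (w : seq (letter U)) :
  coproduct_iter U 0 (symw w) = tword [:: sletter w].
Proof. exact: sliftE. Qed.

Lemma coproduct_iterS (U : graded K) n (x : sym U) :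
  coproduct_iter U n.+1 x = on_first (coproduct U) (coproduct_iter U n x).
Proof. by []. Qed.

Lemma on_firstE (U : graded K) (D : {linear U -> tens U}) y w :
  on_first D (tword (y :: w)) = tcat w (D (lval y)).
Proof. exact: tliftE. Qed.

Lemma on_first_nil (U : graded K) (D : {linear U -> tens U}) :
  on_first D (tword [::]) = 0.
Proof. exact: tliftE. Qed.

Lemma on_first_map (t : tens (Defs.fsym V)) :
  on_first (coproduct W) (tens_map f t) = tens_map f (on_first (coproduct V) t).
Proof.
elim/pres_ind: t => [|a y z hy hz|w]; first by rewrite !raddf0.
  rewrite (linearP (tens_map f)) (linearP (on_first _)) hy hz.
  by rewrite (linearP (on_first _)) (linearP (tens_map f)).
rewrite -/(tword w); case: w => [|y w].
  by rewrite tens_mapE !on_first_nil raddf0.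
by rewrite tens_mapE !on_firstE tens_map_tcat coproduct_map.
Qed.

(** [coproduct_iter U 0] is defined on words; it must be compared with the
    inclusion of arbitrary homogeneous elements, since the image of a word under
    a coalgebra morphism need not be a word. *)
Lemma coproduct0_letter (U : graded K) (x : letter (sym U)) :
  coproduct_iter U 0 (lval x) = tword [:: x].
Proof.
have aux k (y : sym U) (z : letter (sym U)) : ldeg z = k -> lval z = gpr k y ->
    coproduct_iter U 0 (gpr k y) = tword [:: z].
  elim/pres_ind: y z => [|a y y' hy hy'|w] z hd hz.
  - by rewrite !raddf0; apply/esym/(@tword0 K (sym U) [::]); rewrite hz raddf0.
  - have hg u : homog k (gpr k (u : sym U)) by rewrite /homog gprK eqxx.
    rewrite !linearP (hy (mk_letter (hg y))) // (hy' (mk_letter (hg y'))) //.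
    by apply/esym/(tword_eq [::]); rewrite // hz linearP.
  move: hz; rewrite -/(symw w) /= sym_gprE; case: eqP => [ew|_] hz; last first.
    by rewrite raddf0; apply/esym/(@tword0 K (sym U) [::]).
  have <- : sletter w = z; last exact: coproduct_iter0E.
  apply: val_inj.
  rewrite [LHS]surjective_pairing [RHS]surjective_pairing.
  by congr (_, _); [rewrite /= ew -hd|exact/esym/hz].
have /eqP e := valP x; rewrite -[lval x]e; exact: aux.
Qed.

Lemma coproduct_iter_map n x :
  coproduct_iter W n (f x) = tens_map f (coproduct_iter V n x).
Proof.
elim: n => [|n IH]; last by rewrite !coproduct_iterS IH on_first_map.
elim/pres_ind: x => [|a x y hx hy|w]; first by rewrite !raddf0.
  rewrite (linearP f) (linearP (coproduct_iter W 0)) hx hy.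
  by rewrite (linearP (coproduct_iter V 0)) (linearP (tens_map f)).
by rewrite -/(symw w) coproduct_iter0E tens_mapE -coproduct0_letter.
Qed.
End TensorPower.

(** * Coalgebra morphisms do not raise the weight *)

(** The comparison of the two sides of [vee_last_coproduct] in weight [m]
    expresses [m] times the part of [f (symw w)] in Sym^m through the images of
    strictly shorter words, in weight [m - 1]. *)
Lemma coalgebra_map_weight (K : fieldType) (charK : [pchar K] =i pred0)
    (V W : fgraded K) (f : ghom 0 (Defs.fsym V) (Defs.fsym W)) :
  (forall x,
    coproduct W (f x) = tensor_map [:: mk_hmap f; mk_hmap f] (coproduct V x)) ->
  forall m (w : seq (letter V)), (size w < m)%N -> sym_wpr W m (f (symw w)) = 0.
Proof.
move=> f_coalgebra.
have fnil : f (symw [::]) = 0 by rewrite symw_nil; exact: linear0.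
elim=> // m IH w; rewrite ltnS => hw.
case: (posnP m) => [m0|m_gt0].
  move: hw; rewrite m0 leqn0 size_eq0 => /eqP ->.
  by rewrite fnil; exact: linear0.
have m_neq0 : m.+1%:R != 0 :> K by rewrite (pcharf0P K).1.
apply: (scalerI m_neq0); rewrite scaler0.
have := vee_last_coproduct m.+1 (f (symw w)); rewrite ltnS m_gt0 => <-.
rewrite (coproduct_map f_coalgebra).
pose T : {linear tens (sym V) -> sym W} :=
  sym_wpr W m.+1 \o (vee_last W \o tens_map f).
have TE (x y : letter (Defs.fsym V)) : T (tword [:: x; y]) =
    vee_letter (corestr_letter (hmap_letter (mk_hmap f) y))
      (sym_wpr W m (f (lval x))).
  have -> : T (tword [:: x; y]) =
      sym_wpr W m.+1 (vee_last W (tens_map f (tword [:: x; y]))) by [].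
  by rewrite tens_mapE vee_lastE sym_wpr_vee_letter.
rewrite -[LHS]/(T (coproduct V (symw w))) coproduct_linear big1_seq // => p.
case/andP=> _ hp; have hs := unshuffles_size hp; rewrite TE.
(* an empty second part contributes 0; otherwise the first part is shorter *)
case: (posnP (size p.2)) => [/size0nil r0|r_gt0].
  rewrite vee_letter0 ?scaler0 //.
  have fr0 : f (symw p.2) = 0 by rewrite r0.
  exact: etrans (congr1 (corestr W) fr0) (linear0 _).
rewrite [lval _]/(symw p.1.2) IH; last first.
  by rewrite (leq_trans _ hw) // -hs -[leqLHS]addn1 leq_add2l.
by rewrite (linear0 (vee_letter _)) scaler0.
Qed.

(** * Precomposition on the convolution algebra *)

Section Precomposition.
Variables (K : fieldType) (charK : [pchar K] =i pred0) (L L' L'' : linf K).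
Variable H : linf_mor L'' L.

(** A map in the [n]-th step vanishes on the parts of weight less than [n], and
    on a word with fewer than [n] letters [H] has no others. *)
Lemma conv_fil_precomp n (f : Defs.fsym (shift L) -> shift L') :
  linear f -> conv_fil n f ->
  conv_fil n ((fun x : Defs.fsym (shift L'') => f (H x)) : _ -> shift L').
Proof.
move=> f_lin hf w hw.
pose g : {linear sym (shift L) -> shift L'} :=
  HB.pack f (GRing.isLinear.Build K _ _ _ f f_lin).
rewrite -[f _]/(g _).
have gwpr m x : (m < n)%N -> g (sym_wpr (shift L) m x) = 0.
  move=> hm; elim/pres_ind: x => [|a x y hx hy|u]; first by rewrite !raddf0.
    by rewrite (linearP (sym_wpr _ m)) (linearP g) hx hy scaler0 addr0.
  rewrite -/(symw u) sym_wprE; case: eqP => [hu|_]; last exact: linear0.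
  by apply: hf; rewrite hu.
have [N /(_ N (leqnn N)) ->] := sym_wpr_sum (H (symw w)).
rewrite (linear_sum g) big1 // => m _; case: (ltnP m n) => hm; first exact: gwpr.
rewrite (coalgebra_map_weight charK (lmor_coalgebra H)) ?(leq_trans hw) //.
exact: linear0.
Qed.

Lemma conv_lim_precomp (a : nat -> Defs.fsym (shift L) -> shift L')
    (f : Defs.fsym (shift L) -> shift L') :
  (forall m, linear (a m)) -> linear f -> conv_lim a f ->
  @conv_lim K L'' L' (fun m x => a m (H x)) (fun x => f (H x)).
Proof.
move=> a_lin f_lin h n; have [N hN] := h n; exists N => m /hN hm.
apply: (@conv_fil_precomp n (fun x => a m x - f x)) => // s x y.
by rewrite a_lin f_lin scalerBr opprD addrACA.
Qed.

Lemma linear_sumf (U W : lmodType K) I (r : seq I) (P : pred I)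
    (f : I -> U -> W) :
  (forall i, linear (f i)) -> linear (fun x => \sum_(i <- r | P i) f i x).
Proof.
move=> hf s x y; rewrite scaler_sumr -big_split.
by apply: eq_bigr => i _; rewrite hf.
Qed.

Lemma linear_scalef (U W : lmodType K) c (f : U -> W) :
  linear f -> linear (fun x => c *: f x).
Proof. by move=> hf s x y; rewrite hf scalerDr !scalerA mulrC. Qed.

Lemma conv_Q_linear fs : linear (@conv_Q K L L' fs).
Proof.
pose T : {linear sym (shift L) -> shift L'} :=
  corestr _ \o (lQ L' \o (sym_wpr _ (size fs) \o
    (vee _ \o (tensor_map fs \o coproduct_iter _ (size fs).-1)))).
move=> s x y; rewrite /conv_Q -![component _ _ _]/(T _) (linearP T).
case: fs T => [|f [|g fs]] T; rewrite ?subr0 //.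
rewrite (linearP (lQ L)) (linearP (tagged f)) scalerBr [in RHS]scalerA.
by rewrite scalerDr scalerA [s * _]mulrC opprD addrACA.
Qed.

(** The part of a bracket that involves [Q'] needs only that [H] is a coalgebra
    map of degree 0; the summand of the unary bracket that involves [Q] needs
    that [H] is a chain map. *)
Lemma conv_Q_precomp fs x :
  @conv_Q K L'' L' (map (precomp H) fs) x = @conv_Q K L L' fs (H x).
Proof.
rewrite /conv_Q size_map tensor_map_precomp.
rewrite (coproduct_iter_map (lmor_coalgebra H)).
case: fs => [|f [|g fs]] //; congr (_ - _ *: _).
exact: (congr1 (tagged f) (lmorQ H x)).
Qed.

Lemma conv_Q_coef_precomp (l : nat -> conv L L' (-1)) (F : nat -> conv L L' 0)
    i n x :
  conv_Q_coef (fun k => gcomp0 (l k) H) (fun k => gcomp0 (F k) H) i n x =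
  conv_Q_coef l F i n (H x).
Proof.
by apply: eq_bigr => j _; rewrite -conv_Q_precomp /= -map_comp.
Qed.

(** Each clause of the definition asks for membership in the weight filtration or
    for a limit of expressions in the brackets; precomposition with [H] preserves
    both, so [(F(t) H, lambda(t) H)] is a homotopy between the composites. *)
Lemma elementary_homotopic_precomp (F0 F1 : linf_mor L L') :
  elementary_homotopic F0 F1 ->
  elementary_homotopic (linf_comp F0 H) (linf_comp F1 H).
Proof.
case=> [F [l [Fpol lpol ode F_0 F_1]]].
have ghom_linear d (f : conv L L' d) : linear f by move=> s x y; exact: linearP.
have pol d (G : nat -> conv L L' d) :
    poly_mod_fil G -> poly_mod_fil (fun k => gcomp0 (G k) H).
  move=> hG n; have [N hN] := hG n; exists N => i /hN.
  exact/conv_fil_precomp/ghom_linear.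
have eval c (G : linf_mor L L') : series_eval F c (mc_element G) ->
    series_eval (fun k => gcomp0 (F k) H) c (mc_element (linf_comp G H)).
  apply: conv_lim_precomp => [m|s x y].
    by apply: linear_sumf => i; apply/linear_scalef/ghom_linear.
  by rewrite /mc_element (linearP G) (linearP (corestr _)).
exists (fun k => gcomp0 (F k) H), (fun k => gcomp0 (l k) H).
split; [exact: pol|exact: pol| |exact: eval|exact: eval].
move=> i n.
have hc m : linear (fun x : Defs.fsym (shift L) =>
    \sum_(k < m) (k`!%:R)^-1 *: conv_Q_coef l F i k x).
  apply: linear_sumf => k; apply: linear_scalef.
  by apply: linear_sumf => j; exact: conv_Q_linear.
have [N hN] := conv_lim_precomp hc (linear_scalef _ (ghom_linear _ _)) (ode i) n.
exists N => m /hN hm w /hm hw; rewrite -[RHS]hw; congr (_ - _).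
by apply: eq_bigr => k _; rewrite conv_Q_coef_precomp.
Qed.
End Precomposition.

(** * Homotopic morphisms stay homotopic after precomposition *)

Theorem proposition3p6 (K : fieldType) (charK : [pchar K]%R =i pred0)
    (L L' L'' : linf K) (F0 F1 : linf_mor L L') (H : linf_mor L'' L) :
  homotopic F0 F1 -> homotopic (linf_comp F0 H) (linf_comp F1 H).
Proof.
elim=> [G0 G1 h|G0 G1 G2 _ h01 _ h12].
  exact/t_step/elementary_homotopic_precomp.
exact: t_trans h01 h12.
Qed.
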